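(* Let $n \ge 1$ be an integer and let $\Phi : \mathcal{H}_n(\mathbb{C}) \to \mathbb{C}$ be a mapping. Then $\Phi$ satisfies the identity $\Phi(ABA) = \Phi(A)\Phi(B)\Phi(A)$ for all $A, B \in \mathcal{H}_n(\mathbb{C})$ if and only if $\Phi$ has the form $$\Phi(A) = \Psi(|\det A|)\, \eta(\mathrm{Syl}(A)), \qquad A \in \mathcal{H}_n(\mathbb{C}),$$ where $\Psi : [0,\infty) \to \mathbb{C}$ is a multiplicative function, $\eta : \{0,1,\ldots,n\} \to \{-1,1\}$ is an arbitrary mapping, and $\mathrm{Syl}(A)$ is the inertia of $A$.
   Context: $\mathcal{H}_n(\mathbb{C})$ denotes the set of all Hermitian $n\times n$ complex matrices, i.e. $\{A \in \mathcal{M}_n(\mathbb{C}) : A = A^*\}$, where $A^*$ is the conjugate transpose. The inertia $\mathrm{Syl}(A)$ of a Hermitian matrix $A$ means here the number of positive eigenvalues of $A$ (counted with multiplicity). A map $\Psi$ is multiplicative if $\Psi(ab) = \Psi(a)\Psi(b)$ for all $a, b$ in its domain.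
   Formalization: The formal form clause adds that if Ψ is identically 1 then η is constant; without it the ''if'' direction fails, e.g. Ψ=1, η(0)=1, η(k)=-1 for k>0: Φ(0·I·0)=1 but Φ(0)Φ(I)Φ(0)=-1. *)

(* Defs.v *)
From HB Require Import structures.
From mathcomp Require Import all_boot all_order all_algebra.
From mathcomp Require Import interval_inference reals complex.

Set Implicit Arguments.
Unset Strict Implicit.
Unset Printing Implicit Defensive.
Import Order.TTheory GRing.Theory Num.Theory.
Local Open Scope ring_scope.

Record hermmx (C : numClosedFieldType) (n : nat) := Hermmx {
  hermmx_val :> 'M[C]_n;
  hermmxP : hermmx_val \is hermsymmx }.

HB.instance Definition _ (C : numClosedFieldType) (n : nat) :=
  [isSub for @hermmx_val C n].

Lemma hermsymmx_triple (C : numClosedFieldType) (n : nat) (A B : 'M[C]_n) :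
  A \is hermsymmx -> B \is hermsymmx -> A *m B *m A \is hermsymmx.
Proof.
move=> /is_hermitianmxP; rewrite expr0 scale1r => hA.
move=> /is_hermitianmxP; rewrite expr0 scale1r => hB.
apply/is_hermitianmxP; rewrite expr0 scale1r.
by rewrite !trmx_mul !map_mxM -hA -hB mulmxA.
Qed.

Definition herm_triple (C : numClosedFieldType) (n : nat) (A B : hermmx C n) :
    hermmx C n :=
  Hermmx (hermsymmx_triple (hermmxP A) (hermmxP B)).

(* The roots of the characteristic polynomial, repeated according to their
   multiplicity; their order in the sequence is unspecified. *)
Definition eigenvalues (C : numClosedFieldType) (n : nat) (A : 'M[C]_n) :
    seq C :=
  sval (closed_field_poly_normal (char_poly A)).

Lemma char_poly_eigenvalues (C : numClosedFieldType) (n : nat) (A : 'M[C]_n) :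
  char_poly A = \prod_(z <- eigenvalues A) ('X - z%:P).
Proof.
rewrite /eigenvalues; case: closed_field_poly_normal => s /= {1}->.
by rewrite (monicP (char_poly_monic A)) scale1r.
Qed.

Lemma size_eigenvalues (C : numClosedFieldType) (n : nat) (A : 'M[C]_n) :
  size (eigenvalues A) = n.
Proof.
apply: succn_inj.
by rewrite -(size_char_poly A) char_poly_eigenvalues size_prod_XsubC.
Qed.

Lemma count_eigenvalues (C : numClosedFieldType) (n : nat) (A : 'M[C]_n)
    (p : pred C) :
  (count p (eigenvalues A) < n.+1)%N.
Proof. by rewrite ltnS -{2}(size_eigenvalues A) count_size. Qed.

(* In a numClosedFieldType, 0 < z means that z is real and positive. *)
Definition Syl (C : numClosedFieldType) (n : nat) (A : hermmx C n) :
    'I_n.+1 :=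
  Ordinal (count_eigenvalues A (fun z => 0 < z)).

Lemma normc_ge0 (R : realType) (z : R[i]) : 0 <= ComplexField.Normc.normc z.
Proof. by case: z => a b; apply: sqrtr_ge0. Qed.

(* `|z| for z : R[i] lives in R[i]; this is the modulus as an element of
   [0, +oo[ in R. *)
Definition modulus (R : realType) (z : R[i]) : {nonneg R} :=
  NngNum (normc_ge0 z).

Definition nneg_multiplicative (R : realType) (Psi : {nonneg R} -> R[i]) : Prop :=
  forall a b : {nonneg R}, Psi (a%:num * b%:num)%:nng = Psi a * Psi b.

(* Main.v *)
Require Import Defs.
From mathcomp Require Import all_boot all_order all_algebra perm.
From mathcomp Require Import interval_inference reals complex.
From mathcomp Require Import ring.

(** Everything rests on diagonalising by reflections. A Hermitian matrix [A]
    can be written [T D T^-1] with [D] real diagonal and [T] a product of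
    Hermitian involutions ([herm_diag]): a Householder reflection moves an
    eigenvector of [A] onto a multiple of the first basis vector, and induction
    handles the remaining block.

    Suppose that [Phi] satisfies the triple identity. Then [Phi I] equals
    its own cube, so it is 0, in which case [Phi] vanishes, or it is 1 or -1,
    in which case multiplying by it gives a solution of the same identity with
    value 1 at [I]. Assume [Phi I = 1]. For a Hermitian involution [H], the
    identity at [H I H = I] gives [Phi H ^ 2 = 1], hence
    [Phi (H A H) = Phi A] ([unital_conj_invariant]): the value at [A] is the
    value at [D]. On diagonal matrices [Phi] ignores the order of the entries,
    because transpositions are Hermitian involutions, and
    [Phi (D E) = Phi D * Phi E] when the entries of [D] are nonnegative, because
    [D E = D' E D'] with [D'] the square root of [D] ([unital_diagM]). Put
    [Psi a = Phi (diag (a, 1, ..., 1))]. Factoring [D] as its entrywise absolute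
    value times a diagonal matrix of signs, the first factor contributes
    [Psi |det A|] and the second has a value in [{-1, 1}] which depends only on
    the number of positive entries. A zero entry is given the sign -1, so
    singular matrices need no separate treatment. Finally, if [Psi] is
    constantly 1 then [Phi 0 = 1], and [0 A 0 = 0] forces [Phi = 1].

    Conversely, [Psi 0] is idempotent. If it is 1, then [Psi] is constantly 1
    and [Phi] is a constant sign. If it is 0, both sides of the identity vanish
    for singular [A]; for invertible [A] the matrix [A B A] is congruent to [B],
    so it has the same inertia by Sylvester's law ([inertia_congruence]), and
    the two factors [eta (Syl A)] cancel. *)

Set Implicit Arguments.
Unset Strict Implicit.
Unset Printing Implicit Defensive.
Import Order.TTheory GRing.Theory Num.Theory.
Local Open Scope ring_scope.
Local Open Scope sesquilinear_scope.

(** * Conjugate transposes and the Hermitian inner product *)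

Lemma hermsymmx_adjP (C : numClosedFieldType) n (A : 'M[C]_n) :
  reflect (A ^t* = A) (A \is hermsymmx).
Proof. by rewrite is_hermitianmxE expr0 scale1r eq_sym; apply: eqP. Qed.

Lemma adjmxM (C : numClosedFieldType) m n p (A : 'M[C]_(m, n)) (B : 'M_(n, p)) :
  (A *m B) ^t* = B ^t* *m A ^t*.
Proof. by rewrite trmx_mul map_mxM. Qed.

Lemma row_adjE (C : numClosedFieldType) n (u v : 'rV[C]_n) :
  (u *m v ^t*) 0 0 = \sum_i u 0 i * (v 0 i)^*.
Proof. by rewrite mxE; apply: eq_bigr => i _; rewrite !mxE. Qed.

Lemma row_adj_eq0 (C : numClosedFieldType) n (u : 'rV[C]_n) :
  (u *m u ^t*) 0 0 = 0 -> u = 0.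
Proof.
rewrite row_adjE => /psumr_eq0P h; apply/rowP => i; rewrite mxE.
have /eqP := h (fun i _ => mul_conjC_ge0 (u 0 i)) i isT.
by rewrite mul_conjC_eq0 => /eqP.
Qed.

(** * Householder reflections *)

(** The phase is adjusted along with the norm because a reflection can only
    exchange unit vectors whose inner product is real. *)
Lemma unit_rescaling (C : numClosedFieldType) n (v : 'rV[C]_n.+1) : v != 0 ->
  exists2 c : C, (c *: v) *m (c *: v) ^t* = 1%:M & (c * v 0 0)^* = c * v 0 0.
Proof.
move=> v0; set s := (v *m v ^t*) 0 0.
have s0 : s != 0 by apply: contra_neq v0 => /row_adj_eq0.
have s_ge0 : 0 <= s.
  by rewrite /s row_adjE; apply: sumr_ge0 => i _; apply: mul_conjC_ge0.
have rr : (sqrtC s)^* = sqrtC s by apply/CrealP/ger0_real; rewrite sqrtC_ge0.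
have [z zz zr] : exists2 z : C, z * z^* = 1 & (z * v 0 0)^* = z * v 0 0.
  have [->|x0] := eqVneq (v 0 0) 0.
    by exists 1; rewrite ?conjC1 ?mulr1 // !mulr0 conjC0.
  have n0 : `|v 0 0| != 0 by rewrite normr_eq0.
  have nr : `|v 0 0|^* = `|v 0 0| by apply/CrealP/normr_real.
  exists ((v 0 0)^* / `|v 0 0|); rewrite !rmorphM !fmorphV /= ?conjCK nr.
    rewrite mulrACA -invfM -expr2 mulrC (mulrC (v 0 0)^*) -normCK.
    by rewrite mulVf ?expf_neq0.
  by rewrite mulrAC [RHS]mulrAC (mulrC (v 0 0)).
exists (z / sqrtC s); last by rewrite mulrAC rmorphM fmorphV /= rr zr.
have cs : z / sqrtC s * (z / sqrtC s)^* * s = 1.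
  by rewrite rmorphM fmorphV /= rr mulrACA zz mul1r -invfM -expr2 sqrtCK mulVf.
apply/matrixP => i j; rewrite !ord1 [RHS]mxE eqxx mulr1n.
rewrite -cs /s !row_adjE mulr_sumr.
by apply: eq_bigr => k _; rewrite !mxE rmorphM /=; ring.
Qed.

Lemma unit_row_reflection (C : numClosedFieldType) n (u : 'rV[C]_n.+1) :
  u *m u ^t* = 1%:M -> (u 0 0)^* = u 0 0 ->
  exists H : 'M[C]_n.+1, [/\ H \is hermsymmx, H *m H = 1%:M & row 0 H = u].
Proof.
set x := u 0 0 => uu xr; pose e : 'rV[C]_n.+1 := delta_mx 0 0.
have ee : e *m e ^t* = 1%:M.
  rewrite /e trmx_delta map_delta_mx mul_delta_mx.
  by apply/matrixP => i j; rewrite !ord1 !mxE.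
have ue : u *m e ^t* = x%:M.
  rewrite /e trmx_delta map_delta_mx -colE.
  by apply/matrixP => i j; rewrite !ord1 /x !mxE mulr1n.
have eu : e *m u ^t* = x%:M.
  have := congr1 (fun M : 'M[C]_1 => M ^t*) ue.
  by rewrite adjmxM trmxCK tr_scalar_mx map_scalar_mx /= xr.
have [w wdef] : exists w, w = u - e by exists (u - e).
(* The squared norm of w; when it vanishes w = 0 and, division by 0 being 0,
   the formula for H below gives the identity. *)
pose q := 2 - 2 * x.
have wE : w ^t* = u ^t* - e ^t* by rewrite wdef linearB /= map_mxB.
have ww : w *m w ^t* = q%:M.
  rewrite wE wdef mulmxBr !mulmxBl uu ee ue eu -!raddfB /=; congr _%:M.
  by rewrite /q; ring.
have ew : e *m w ^t* = (x - 1)%:M by rewrite wE mulmxBr eu ee -raddfB.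
pose H := 1%:M - (2 / q) *: (w ^t* *m w).
have qr : q^* = q by rewrite /q rmorphB rmorphM /= xr !conjC_nat.
exists H; split.
- apply/hermsymmx_adjP; rewrite /H linearB linearZ /= map_mxB map_mxZ.
  rewrite tr_scalar_mx map_scalar_mx /= conjC1 rmorphM fmorphV /= conjC_nat qr.
  by rewrite adjmxM trmxCK.
- have [q0|q0] := eqVneq q 0.
    by rewrite /H q0 invr0 mulr0 scale0r subr0 mulmx1.
  rewrite /H mulmxBl mul1mx mulmxBr mulmx1 -scalemxAl -scalemxAr.
  have -> : w ^t* *m w *m (w ^t* *m w) = q *: (w ^t* *m w).
    by rewrite mulmxA -(mulmxA (w ^t*)) ww mul_mx_scalar scalemxAl.
  rewrite !scalerA; set P := _ *m w.
  have -> : 2 / q * (2 / q) * q = 2 / q + 2 / q by field.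
  by rewrite scalerDl; set Z := _ *: P; rewrite opprB addrK subrK.
- rewrite rowE -/e /H mulmxBr mulmx1 -scalemxAr mulmxA ew.
  rewrite mul_scalar_mx scalerA.
  have [q0|q0] := eqVneq q 0.
    rewrite q0 invr0 mulr0 mul0r scale0r subr0.
    suff : w = 0 by move/eqP; rewrite wdef subr_eq0 => /eqP ->.
    by apply: row_adj_eq0; rewrite ww q0 mxE.
  have -> : 2 / q * (x - 1) = -1.
    by apply: (mulIf q0); rewrite mulrAC divfK // /q; ring.
  by rewrite scaleN1r opprK wdef addrC subrK.
Qed.

Lemma row_reflection (C : numClosedFieldType) n (v : 'rV[C]_n.+1) : v != 0 ->
  exists H : 'M[C]_n.+1, [/\ H \is hermsymmx, H *m H = 1%:M
    & exists c, row 0 H = c *: v].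
Proof.
move=> /unit_rescaling[c cu cr].
have [|H [hH HH rH]] := unit_row_reflection cu; first by rewrite mxE.
by exists H; split => //; exists c.
Qed.

(** * Diagonalisation by Hermitian involutions *)

(** The transformation is kept as a chain of conjugations by single involutions,
    and not as one unitary matrix, because a chain is what a map satisfying the
    triple identity can follow step by step. *)
Inductive refl_conj (C : numClosedFieldType) n (D : 'M[C]_n) :
    'M[C]_n -> Prop :=
| refl_conj_refl : refl_conj D D
| refl_conj_step H A : H \is hermsymmx -> H *m H = 1%:M -> refl_conj D A ->
    refl_conj D (H *m A *m H).

Lemma refl_conj_unitary (C : numClosedFieldType) n (D A : 'M[C]_n) :
  refl_conj D A ->
  exists2 T : 'M[C]_n, T *m T ^t* = 1%:M & A = T *m D *m T ^t*.
Proof.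
elim=> [|H {}A /hermsymmx_adjP hH HH _ [T TT ->]].
  exists 1%:M; rewrite tr_scalar_mx map_scalar_mx /= conjC1 ?mulmx1 //.
  by rewrite mul1mx.
exists (H *m T); rewrite adjmxM hH !mulmxA //.
by rewrite -(mulmxA H) TT mulmx1.
Qed.

Lemma refl_conj_block (C : numClosedFieldType) n (a : C) (D A : 'M[C]_n) :
  refl_conj D A ->
  refl_conj (block_mx a%:M 0 0 D : 'M_(1 + n)) (block_mx a%:M 0 0 A).
Proof.
elim=> [|H {}A /hermsymmx_adjP hH HH _ IH]; first exact: refl_conj_refl.
pose H' : 'M[C]_(1 + n) := block_mx 1%:M 0 0 H.
have -> : block_mx a%:M 0 0 (H *m A *m H)
    = H' *m block_mx a%:M 0 0 A *m H'.
  by rewrite !mulmx_block !(mulmx0, mul0mx, mulmx1, mul1mx, addr0, add0r).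
apply: refl_conj_step => //; last first.
  rewrite mulmx_block HH !(mulmx0, mul0mx, mulmx1, addr0, add0r).
  by rewrite -scalar_mx_block.
apply/hermsymmx_adjP; rewrite tr_block_mx map_block_mx hH !trmx0 !map_mx0.
by rewrite tr_scalar_mx map_scalar_mx /= conjC1.
Qed.

Lemma herm_diag (C : numClosedFieldType) n (A : 'M[C]_n) :
  A \is hermsymmx ->
  exists2 d : 'rV[C]_n, d \is a realmx & refl_conj (diag_mx d) A.
Proof.
elim: n A => [|n IH] A /hermsymmx_adjP hA.
  exists 0; first by apply/mxOverP => i [].
  by rewrite (flatmx0 A) (flatmx0 (diag_mx _)); apply: refl_conj_refl.
have [a /eigenvalueP[v vA v0]] := eigenvalue_closed A (ltn0Sn n).
have [H [/hermsymmx_adjP hH HH [c cH]]] := row_reflection v0.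
pose B : 'M[C]_(1 + n) := H *m A *m H.
have hB : B ^t* = B by rewrite /B !adjmxM hA hH mulmxA.
(* The first basis vector is sent by H to a multiple of v, by A to a times
   this, and back by H. *)
have rB : row 0 B = a *: delta_mx 0 0.
  rewrite /B rowE !mulmxA -rowE cH -scalemxAl vA scalerA mulrC -scalerA -cH.
  by rewrite -scalemxAl -row_mul HH rowE mulmx1.
have AE : A = H *m B *m H.
  by rewrite /B !mulmxA HH mul1mx -mulmxA HH mulmx1.
clearbody B.
have B0 j : B 0 j = a * (j == 0)%:R.
  by have /rowP/(_ j) := rB; rewrite !mxE eqxx.
have Bj i : B i 0 = (B 0 i)^* by rewrite -[in LHS]hB !mxE.
have ar : a^* = a by have := Bj 0; rewrite B0 eqxx mulr1.
have BE : B = block_mx a%:M 0 0 (drsubmx B).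
  rewrite -[LHS]submxK; congr block_mx; apply/matrixP => i j;
    rewrite !ord1 ?mxE /=.
  - by rewrite lshift0 B0 !eqxx mulr1.
  - by rewrite lshift0 B0 mulr0.
  - by rewrite lshift0 Bj B0 mulr0 conjC0.
have [|d dr dB] := IH (drsubmx B).
  by apply/hermsymmx_adjP; rewrite trmx_drsub map_drsubmx hB.
exists (row_mx a%:M d : 'rV_(1 + n)).
  apply/mxOverP => i j; rewrite mxE; case: splitP => k _.
    by rewrite !ord1 mxE mulr1n; apply/CrealP.
  exact: (mxOverP dr).
rewrite AE.
apply: refl_conj_step => //; first exact/hermsymmx_adjP.
have -> : diag_mx (row_mx a%:M d : 'rV_(1 + n)) = block_mx a%:M 0 0 (diag_mx d).
  rewrite diag_mx_row; congr block_mx.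
  by apply/matrixP => i j; rewrite !ord1 !mxE.
by rewrite BE; apply: refl_conj_block.
Qed.

(** * Eigenvalues and Sylvester's law of inertia *)

Lemma char_poly_conj (F : fieldType) n (T D S : 'M[F]_n) :
  T *m S = 1%:M -> char_poly (T *m D *m S) = char_poly D.
Proof.
move=> TS; rewrite /char_poly /char_poly_mx !map_mxM /=.
set T' := map_mx polyC T; set S' := map_mx polyC S; set D' := map_mx _ D.
have TS' : T' *m S' = 1%:M by rewrite -map_mxM TS map_mx1.
have -> : 'X%:M - T' *m D' *m S' = T' *m ('X%:M - D') *m S'.
  by rewrite mulmxBr mulmxBl scalar_mxC -(mulmxA _ T') TS' mulmx1.
by rewrite !det_mulmx mulrAC -det_mulmx TS' det1 mul1r.
Qed.

Lemma refl_conj_eigenvalues (C : numClosedFieldType) n (d : 'rV[C]_n)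
    (A : 'M[C]_n) :
  refl_conj (diag_mx d) A -> perm_eq (eigenvalues A) [seq d 0 i | i : 'I_n].
Proof.
move=> dA; have [T TT AE] := refl_conj_unitary dA.
apply: prod_XsubC_eq; rewrite -char_poly_eigenvalues AE (char_poly_conj _ TT).
rewrite char_poly_trig ?diag_mx_is_trig // big_image /=.
by apply: eq_bigr => i _; rewrite mxE eqxx.
Qed.

Lemma refl_conj_count (C : numClosedFieldType) n (d : 'rV[C]_n) (A : 'M[C]_n) :
  refl_conj (diag_mx d) A ->
  count (fun z => 0 < z) (eigenvalues A) = #|[set i | 0 < d 0 i]|.
Proof.
move=> dA; rewrite (seq.permP (refl_conj_eigenvalues dA)) count_map cardE.
rewrite -size_filter /enum_mem /= -filter_predI.
by congr size; apply: eq_filter => i; rewrite !inE andbT.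
Qed.

Lemma refl_conj_det (C : numClosedFieldType) n (d : 'rV[C]_n) (A : 'M[C]_n) :
  refl_conj (diag_mx d) A -> \det A = \prod_i d 0 i.
Proof.
move=> dA; have [T TT ->] := refl_conj_unitary dA.
by rewrite !det_mulmx mulrAC -det_mulmx TT det1 mul1r det_diag.
Qed.

(** If [d] had more positive entries than [e], a dimension count would give a
    nonzero [x] supported on the positive entries of [d] such that [x *m M]
    vanishes on the positive entries of [e]; the form would then be both
    positive and nonpositive at [x]. *)
Lemma sylvester_le (C : numClosedFieldType) n (M : 'M[C]_n) (d e : 'rV[C]_n) :
  e \is a realmx -> diag_mx d = M *m diag_mx e *m M ^t* ->
  (#|[set i | 0 < d 0%R i]%R| <= #|[set i | 0 < e 0%R i]%R|)%N.
Proof.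
move=> er dE; set P := [set i | _]; set Q := [set i | _ < e _ _].
rewrite leqNgt; apply/negP => ltQP.
pose K : 'M[C]_(#|P|, #|Q|) := \matrix_(i, j) M (enum_val i) (enum_val j).
have /rowV0Pn[v /sub_kermxP vK v0] : kermx K != 0.
  rewrite kermx_eq0 /row_free neq_ltn (leq_ltn_trans _ ltQP) //.
  exact: rank_leq_col.
pose x : 'rV[C]_n := \sum_i v 0 i *: delta_mx 0 (enum_val i).
have xP i : x 0 (enum_val i) = v 0 i.
  rewrite summxE (bigD1 i) //= !mxE !eqxx mulr1 big1 ?addr0 // => k ki.
  by rewrite !mxE (inj_eq enum_val_inj) eq_sym (negPf ki) mulr0.
have xN i : i \notin P -> x 0 i = 0.
  move=> iP; rewrite summxE big1 // => k _; rewrite !mxE eqxx /=.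
  by case: eqP iP => [->|_ _]; rewrite ?enum_valP // mulr0.
have diagq (f : 'rV[C]_n) (y : 'rV[C]_n) :
    (y *m diag_mx f *m y ^t*) 0 0 = \sum_i f 0 i * (y 0 i * (y 0 i)^*).
  rewrite row_adjE; apply: eq_bigr => i _.
  by rewrite mul_mx_diag mxE mulrAC mulrC.
have := diagq d x; rewrite dE.
pose y := x *m M.
have -> : x *m (M *m diag_mx e *m M ^t*) *m x ^t* = y *m diag_mx e *m y ^t*.
  by rewrite /y adjmxM !mulmxA.
rewrite diagq => yx.
have yQ i : i \in Q -> y 0 i = 0.
  move=> iQ; have /rowP/(_ (enum_rank_in iQ i)) := vK.
  rewrite /y !mxE => {2}<-; rewrite (bigID (mem P)) /= addrC big1 ?add0r.
    by rewrite big_enum_val; apply: eq_bigr => k _; rewrite xP mxE enum_rankK_in.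
  by move=> k /xN ->; rewrite mul0r.
have yle : \sum_i e 0 i * (y 0 i * (y 0 i)^*) <= 0.
  apply: sumr_le0 => i _.
  have [iQ|] := boolP (i \in Q); first by rewrite yQ // mul0r mulr0.
  rewrite inE -real_leNgt ?real0 ?(mxOverP er) // => e0.
  exact: mulr_le0_ge0 e0 (mul_conjC_ge0 _).
have xge i : 0 <= d 0 i * (x 0 i * (x 0 i)^*).
  have [|/xN ->] := boolP (i \in P); last by rewrite mul0r mulr0.
  by rewrite inE => /ltW d0; apply: mulr_ge0 d0 (mul_conjC_ge0 _).
have x0 : \sum_i d 0 i * (x 0 i * (x 0 i)^*) = 0.
  by apply/eqP; rewrite eq_le -{1}yx yle sumr_ge0.
case/negP: v0; apply/eqP/rowP => k; rewrite mxE -xP.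
move/psumr_eq0P: x0 => /(_ (fun i _ => xge i)) /(_ (enum_val k) isT) /eqP.
have := enum_valP k; rewrite inE => /gt_eqF dk.
by rewrite mulf_eq0 dk mul_conjC_eq0 => /eqP.
Qed.

Lemma inertia_congruence (C : numClosedFieldType) n (A B : hermmx C n)
    (M : 'M[C]_n) :
  M \in unitmx -> A = M *m B *m M ^t* :> 'M_n -> Syl A = Syl B.
Proof.
have Syl_le (A' B' : hermmx C n) N :
    A' = N *m B' *m N ^t* :> 'M_n -> (Syl A' <= Syl B')%N.
  have [d dr dA] := herm_diag (hermmxP A').
  have [e er eB] := herm_diag (hermmxP B').
  rewrite /= (refl_conj_count dA) (refl_conj_count eB) => AB.
  have [S SS AS] := refl_conj_unitary dA.
  have [T TT BT] := refl_conj_unitary eB.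
  apply: (@sylvester_le _ _ (S ^t* *m N *m T)) => //.
  have SS' := mulmx1C SS.
  have -> : diag_mx d = S ^t* *m A' *m S.
    by rewrite AS !mulmxA SS' mul1mx -mulmxA SS' mulmx1.
  by rewrite AB BT !adjmxM trmxCK !mulmxA.
move=> uM AB; apply/val_inj/eqP; rewrite eqn_leq (Syl_le _ _ _ AB) /=.
apply: (Syl_le _ _ (invmx M)); rewrite AB !mulmxA mulVmx // mul1mx -mulmxA.
by rewrite -adjmxM mulVmx // trmx1 map_mx1 mulmx1.
Qed.

(** * Real diagonal matrices *)

Local Open Scope complex_scope.

Lemma diag_hermsymmx (R : realType) n (f : 'I_n -> R) :
  diag_mx (\row_i (f i)%:C) \is hermsymmx.
Proof.
apply/hermsymmx_adjP; rewrite tr_diag_mx map_diag_mx; congr diag_mx.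
by apply/rowP => i; rewrite !mxE; apply/CrealP/complex_realP; exists (f i).
Qed.

Definition real_diag (R : realType) n (f : 'I_n -> R) : hermmx R[i] n :=
  Hermmx (diag_hermsymmx f).

Lemma eq_real_diag (R : realType) n (f g : 'I_n -> R) :
  f =1 g -> real_diag f = real_diag g.
Proof.
move=> fg; apply: val_inj => /=; congr diag_mx.
by apply/rowP => i; rewrite !mxE fg.
Qed.

Lemma diag_const1 (R : realType) n :
  diag_mx (\row_(i < n) (1 : R)%:C) = 1%:M.
Proof. by apply/matrixP => i j; rewrite !mxE. Qed.

Lemma real_diag_triple (R : realType) n (f g : 'I_n -> R) :
  herm_triple (real_diag f) (real_diag g)
  = real_diag (fun i => f i * g i * f i).
Proof.
apply: val_inj => /=; rewrite !mulmx_diag; congr diag_mx.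
by apply/rowP => i; rewrite !mxE !rmorphM.
Qed.

Lemma hermmx_diag (R : realType) n (A : hermmx R[i] n) :
  exists f : 'I_n -> R, refl_conj (real_diag f) A.
Proof.
have [d /mxOverP dr dA] := herm_diag (hermmxP A).
exists (fun i => complex.Re (d 0 i)).
rewrite /=; suff -> : \row_i (complex.Re (d 0 i))%:C = d by [].
by apply/rowP => i; rewrite mxE RRe_real.
Qed.

Lemma refl_conj_Syl (R : realType) n (f : 'I_n -> R) (A : hermmx R[i] n) :
  refl_conj (real_diag f) A -> Syl A = #|[pred i | 0 < f i]| :> nat.
Proof.
move=> fA; rewrite /= (refl_conj_count fA) -!sum1_card.
by apply: eq_bigl => i; rewrite !inE mxE ltcR.
Qed.

Lemma refl_conj_modulus_det (R : realType) n (f : 'I_n -> R)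
    (A : hermmx R[i] n) :
  refl_conj (real_diag f) A -> (modulus (\det A))%:num = \prod_i `|f i|.
Proof.
move=> fA; rewrite /= (refl_conj_det fA).
rewrite (big_morph _ (@ComplexField.Normc.normcM R) (@ComplexField.Normc.normc1 R)).
by apply: eq_bigr => i _; rewrite mxE /= expr0n addr0 sqrtr_sqr.
Qed.

Lemma card_eq_perm n (b c : pred 'I_n) :
  #|b| = #|c| -> exists s : 'S_n, forall i, b i = c (s i).
Proof.
move=> bc; pose t (p : pred 'I_n) := [tuple p i | i < n].
have countT p : count_mem true (t p) = #|p|.
  rewrite /= count_map cardE size_filter -enumT.
  by apply: eq_count => i; rewrite /= eqb_id.
have countF p : count_mem false (t p) = (n - #|p|)%N.
  have := count_predC (pred1 true) (t p); rewrite size_tuple => nE.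
  by rewrite -countT -[X in (X - _)%N]nE addKn; apply: eq_count => -[].
have /tuple_permP[s sE] : perm_eq (t b) (t c).
  by apply/allP => -[] _; apply/eqP; rewrite ?countT ?countF bc.
exists s => i.
have /(congr1 (fun u => nth false u i)) := sE.
by rewrite -!tnth_nth !tnth_mktuple.
Qed.

Lemma card_ord_lt n k : (k <= n)%N -> #|[pred i : 'I_n | (i < k)%N]| = k.
Proof.
move=> kn; rewrite -sum1_card.
transitivity (\sum_(i < n | (i < k)%N) 1)%N; first by apply: eq_bigl.
by rewrite -(big_ord_widen n (fun=> 1%N) kn) sum1_card card_ord.
Qed.

(** * Maps satisfying the triple identity *)

Definition triple_multiplicative (R : realType) n
    (Phi : hermmx R[i] n -> R[i]) : Prop :=
  forall A B, Phi (herm_triple A B) = Phi A * Phi B * Phi A.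

Definition unital (R : realType) n (Phi : hermmx R[i] n -> R[i]) : Prop :=
  Phi (real_diag (fun=> 1)) = 1.

Lemma unital_involution (R : realType) n (Phi : hermmx R[i] n -> R[i])
    (H : hermmx R[i] n) :
  triple_multiplicative Phi -> unital Phi ->
  H *m H = 1%:M -> Phi H * Phi H = 1.
Proof.
rewrite /unital => tPhi Phi1 HH.
rewrite -[LHS]mulr1 mulrAC -{1}Phi1 -tPhi -Phi1; congr Phi.
by apply: val_inj; rewrite /= diag_const1 mulmx1.
Qed.

Lemma unital_conj_invariant (R : realType) n (Phi : hermmx R[i] n -> R[i])
    (D A : hermmx R[i] n) :
  triple_multiplicative Phi -> unital Phi -> refl_conj D A -> Phi A = Phi D.
Proof.
move=> tPhi Phi1; case: A => A hA /= DA.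
elim: DA hA => [|H {}A hH HH DA IH] hA; first by congr Phi; apply: val_inj.
have hA' : A \is hermsymmx.
  have -> : A = H *m (H *m A *m H) *m H.
    by rewrite !mulmxA HH mul1mx -mulmxA HH mulmx1.
  exact: hermsymmx_triple.
rewrite -(IH hA') -[RHS]mulr1.
rewrite -(@unital_involution _ _ _ (Hermmx hH) tPhi Phi1 HH) mulrCA mulrA -tPhi.
by congr Phi; apply: val_inj.
Qed.

(** The nonnegative factor is split into two equal square roots, placed on both
    sides of the other factor; the case [g = 1] evaluates them. *)
Lemma unital_diagM (R : realType) n (Phi : hermmx R[i] n -> R[i])
    (f g : 'I_n -> R) :
  triple_multiplicative Phi -> unital Phi -> (forall i, 0 <= f i) ->
  Phi (real_diag (fun i => f i * g i)) = Phi (real_diag f) * Phi (real_diag g).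
Proof.
rewrite /unital => tPhi Phi1 f0; pose r i := Num.sqrt (f i).
have rr i : r i * r i = f i by rewrite -expr2 sqr_sqrtr.
have sq h : Phi (real_diag (fun i => f i * h i))
    = Phi (real_diag r) * Phi (real_diag h) * Phi (real_diag r).
  rewrite -tPhi real_diag_triple; congr Phi; apply: eq_real_diag => i.
  by rewrite mulrAC rr.
rewrite sq mulrAC; congr (_ * _).
rewrite -[LHS]mulr1 mulrAC -Phi1 -sq; congr Phi; apply: eq_real_diag => i.
by rewrite mulr1.
Qed.

Lemma unital_diag_prod (R : realType) n (Phi : hermmx R[i] n -> R[i])
    (I : Type) (r : seq I) (f : I -> 'I_n -> R) :
  triple_multiplicative Phi -> unital Phi -> (forall k i, 0 <= f k i) ->
  Phi (real_diag (fun i => \prod_(k <- r) f k i))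
  = \prod_(k <- r) Phi (real_diag (f k)).
Proof.
rewrite /unital => tPhi Phi1 f0; elim: r => [|k r IH].
  by rewrite big_nil -Phi1; congr Phi; apply: eq_real_diag => i; rewrite big_nil.
rewrite big_cons -IH -unital_diagM //; congr Phi; apply: eq_real_diag => i.
by rewrite big_cons.
Qed.

Lemma unital_diag_tperm (R : realType) n (Phi : hermmx R[i] n -> R[i])
    (f : 'I_n -> R) (j k : 'I_n) :
  triple_multiplicative Phi -> unital Phi ->
  Phi (real_diag (fun i => f (tperm j k i))) = Phi (real_diag f).
Proof.
move=> tPhi Phi1; apply: unital_conj_invariant => //.
have -> : real_diag (fun i => f (tperm j k i))
    = tperm_mx j k *m real_diag f *m tperm_mx j k :> 'M_n.
  rewrite -xrowE -xcolE; apply/matrixP => i l; rewrite !mxE (inj_eq perm_inj).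
  by case: eqP => [->|]; rewrite ?mxE.
apply: refl_conj_step; last exact: refl_conj_refl.
- by apply/hermsymmx_adjP; rewrite tr_tperm_mx map_tperm_mx.
- by rewrite /tperm_mx -perm_mxM tperm2 perm_mx1.
Qed.

Lemma unital_diag_perm (R : realType) n (Phi : hermmx R[i] n -> R[i])
    (f : 'I_n -> R) (s : 'S_n) :
  triple_multiplicative Phi -> unital Phi ->
  Phi (real_diag (fun i => f (s i))) = Phi (real_diag f).
Proof.
move=> tPhi Phi1; have [ts -> _] := prod_tpermP s.
elim: ts f => [|t ts IH] f.
  by congr Phi; apply: eq_real_diag => i; rewrite big_nil perm1.
rewrite -(IH f) -(unital_diag_tperm _ t.1 t.2 tPhi Phi1); congr Phi.
by apply: eq_real_diag => i; rewrite big_cons permM tpermK.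
Qed.

Definition diag_entry (R : realType) n (k : 'I_n) (a : R) (i : 'I_n) : R :=
  if i == k then a else 1.

Definition diag_signs (R : realType) n (b : pred 'I_n) (i : 'I_n) : R :=
  if b i then 1 else -1.

(** The statement is for size [n.+1] so that [Psi a] can be read off at the
    diagonal matrix with entries [a, 1, ..., 1]. When [Psi] is constantly 1, the
    normalisation makes the constant [eta] equal to 1. *)
Lemma unital_form (R : realType) n (Phi : hermmx R[i] n.+1 -> R[i]) :
  triple_multiplicative Phi -> unital Phi ->
  exists (Psi : {nonneg R} -> R[i]) (eta : 'I_n.+2 -> R[i]),
     [/\ nneg_multiplicative Psi,
         forall k, eta k = -1 \/ eta k = 1,
         (forall a, Psi a = 1) -> forall k, eta k = 1
       & forall A, Phi A = Psi (modulus (\det A)) * eta (Syl A)].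
Proof.
move=> tPhi Phi1.
pose Psi (a : {nonneg R}) :=
  Phi (real_diag (diag_entry (ord0 : 'I_n.+1) a%:num)).
pose eta (k : 'I_n.+2) :=
  Phi (real_diag (diag_signs R (fun i : 'I_n.+1 => i < k)%N)).
have entry0 (k i : 'I_n.+1) (a : {nonneg R}) : 0 <= diag_entry k a%:num i.
  by rewrite /diag_entry; case: eqP.
have PsiM : nneg_multiplicative Psi.
  move=> a b; rewrite /Psi -unital_diagM //; congr Phi; apply: eq_real_diag => i.
  by rewrite /diag_entry; case: eqP => //; rewrite mulr1.
have Psi1 : Psi 1%:nng = 1.
  rewrite /Psi -[RHS]Phi1; congr Phi; apply: eq_real_diag => i.
  by rewrite /diag_entry; case: eqP.
have PsiE (f : 'I_n.+1 -> R) (a : {nonneg R}) :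
    a%:num = \prod_i `|f i| -> Phi (real_diag (fun i => `|f i|)) = Psi a.
  have Pk k : Phi (real_diag (diag_entry k `|f k|)) = Psi `|f k|%:nng.
    rewrite /Psi -(unital_diag_tperm _ ord0 k tPhi Phi1); congr Phi.
    apply: eq_real_diag => i; rewrite /diag_entry.
    by rewrite (can2_eq (tpermK ord0 k) (tpermK ord0 k)) tpermR.
  move=> aE; transitivity (\prod_k Psi `|f k|%:nng).
    under [RHS]eq_bigr do rewrite -Pk.
    rewrite -unital_diag_prod // => [|k i]; last exact: (entry0 k i `|f k|%:nng).
    congr Phi; apply: eq_real_diag => i.
    rewrite (bigD1 i) //= /diag_entry eqxx big1 ?mulr1 // => k ki.
    by rewrite eq_sym (negPf ki).
  elim: (index_enum _) a aE => [|k r IH] a; rewrite !(big_nil, big_cons) => aE.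
    by rewrite -Psi1; congr Psi; apply: val_inj.
  have r0 : 0 <= \prod_(i <- r) `|f i| by apply: prodr_ge0.
  by rewrite (IH (NngNum r0)) // -PsiM; congr Psi; apply: val_inj.
have etaE (b : pred 'I_n.+1) (k : 'I_n.+2) :
    #|b| = k :> nat -> Phi (real_diag (diag_signs R b)) = eta k.
  move=> bk; have [|s sE] := @card_eq_perm _ b [pred i : 'I_n.+1 | i < k]%N.
    by rewrite card_ord_lt // -ltnS.
  rewrite /eta -[RHS](unital_diag_perm _ s tPhi Phi1); congr Phi.
  by apply: eq_real_diag => i; rewrite /diag_signs sE.
have PhiE A : Phi A = Psi (modulus (\det A)) * eta (Syl A).
  have [f fA] := hermmx_diag A.
  rewrite (unital_conj_invariant tPhi Phi1 fA).
  rewrite -(etaE _ _ (esym (refl_conj_Syl fA))).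
  rewrite -(PsiE _ _ (refl_conj_modulus_det fA)) -unital_diagM //.
  congr Phi; apply: eq_real_diag => i; rewrite /diag_signs /=.
  case: ltP => f0; first by rewrite mulr1 gtr0_norm.
  by rewrite mulrN mulr1 ler0_norm // opprK.
exists Psi, eta; split => // [k|Psi_1 k].
  have /eqP : eta k * eta k = 1.
    apply: unital_involution => //=; rewrite mulmx_diag; apply/matrixP => i j.
    rewrite !mxE /diag_signs; case: ifP => _; first by rewrite mulr1.
    by rewrite -rmorphM mulrNN mulr1.
  by rewrite -expr2 sqrf_eq1 => /orP[] /eqP; tauto.
have Phi0 : Phi (real_diag (fun=> 0)) = 1.
  rewrite -(Psi_1 0%:nng).
  transitivity (Phi (real_diag (fun i : 'I_n.+1 => `|0 : R|))).
    by congr Phi; apply: eq_real_diag => i; rewrite normr0.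
  by apply: PsiE; rewrite big_ord_recl normr0 mul0r.
rewrite -[LHS]mul1r -[LHS]mulr1 -Phi0 -tPhi real_diag_triple.
by congr Phi; apply: eq_real_diag => i; rewrite mulr0.
Qed.

Lemma form_triple_multiplicative (R : realType) n
    (Phi : hermmx R[i] n -> R[i]) (Psi : {nonneg R} -> R[i])
    (eta : 'I_n.+1 -> R[i]) :
  nneg_multiplicative Psi -> (forall k, eta k = -1 \/ eta k = 1) ->
  ((forall a, Psi a = 1) -> forall j k, eta j = eta k) ->
  (forall A, Phi A = Psi (modulus (\det A)) * eta (Syl A)) ->
  triple_multiplicative Phi.
Proof.
move=> PsiM eta1 etac PhiE A B.
have ee k : eta k * eta k = 1 by case: (eta1 k) => ->; rewrite ?mulrNN mulr1.
have modM (z w : R[i]) :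
    Psi (modulus (z * w)) = Psi (modulus z) * Psi (modulus w).
  rewrite -PsiM; congr Psi; apply: val_inj.
  by rewrite /= ComplexField.Normc.normcM.
have Psi0M a : Psi 0%:nng * Psi a = Psi 0%:nng.
  by rewrite -PsiM; congr Psi; apply: val_inj; rewrite /= mul0r.
rewrite !PhiE /= !det_mulmx !modM.
have -> : forall p q a b : R[i],
    p * a * (q * b) * (p * a) = p * q * p * (b * (a * a)).
  by move=> *; ring.
rewrite ee mulr1.
have [P0|P0] := eqVneq (Psi 0%:nng) 1.
  rewrite (etac _ (Syl (herm_triple A B)) (Syl B)) // => a.
  by rewrite -[LHS]mul1r -P0 Psi0M.
have {}P0 : Psi 0%:nng = 0.
  apply: contra_neq_eq P0 => P0; apply: (mulfI P0).
  by rewrite Psi0M mulr1.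
have [A0|A0] := eqVneq (\det A) 0.
  have -> : modulus (\det A) = 0%:nng.
    by apply: val_inj; rewrite /= A0 ComplexField.Normc.normc0.
  by rewrite P0 !mul0r.
congr (_ * eta _); apply: (@inertia_congruence _ _ _ _ A).
  by rewrite unitmxE unitfE.
by rewrite (hermsymmx_adjP _ (hermmxP A)).
Qed.

(* The third conjunct is vacuous unless Psi is constantly 1. It cannot be
   dropped: for Psi = 1 and a non-constant eta, A |-> eta (Syl A) violates the
   identity at A = 0. *)
Theorem theorem3p3 (R : realType) (n : nat) (hn : (1 <= n)%N)
    (Phi : hermmx R[i] n -> R[i]) :
  (forall A B : hermmx R[i] n, Phi (herm_triple A B) = Phi A * Phi B * Phi A)
  <->
  (exists (Psi : {nonneg R} -> R[i]) (eta : 'I_n.+1 -> R[i]),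
     [/\ nneg_multiplicative Psi,
         forall k, eta k = -1 \/ eta k = 1,
         (forall a, Psi a = 1) -> forall j k, eta j = eta k
       & forall A : hermmx R[i] n,
           Phi A = Psi (modulus (\det A)) * eta (Syl A)]).
Proof.
split=> [tPhi|[Psi [eta [PsiM eta1 etac PhiE]]]]; last first.
  exact: form_triple_multiplicative PhiE.
case: n hn Phi tPhi => // n _ Phi tPhi.
pose I : hermmx R[i] n.+1 := real_diag (fun=> 1).
have triple1 A : herm_triple I A = A.
  by apply: val_inj; rewrite /= diag_const1 mul1mx mulmx1.
have PhiI A : Phi A = Phi I * Phi A * Phi I by rewrite -tPhi triple1.
have [c0|c0] := eqVneq (Phi I) 0.
  exists (fun=> 0), (fun=> 1); split=> [a b|k||A]; rewrite ?mul0r //.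
    by right.
  by rewrite PhiI c0 !mul0r.
have cc : Phi I * Phi I = 1 by apply: (mulIf c0); rewrite mul1r -PhiI.
have [|| Psi [eta [PsiM eta1 etac PhiE]]] :=
    @unital_form R n (fun A => Phi I * Phi A).
- by move=> A B; rewrite tPhi; ring: cc.
- by [].
exists Psi, (fun k => Phi I * eta k); split=> //.
- move=> k; have [->|->] : Phi I = -1 \/ Phi I = 1.
    by move/eqP: cc; rewrite -expr2 sqrf_eq1 => /orP[] /eqP; tauto.
  + by case: (eta1 k) => ->; [right; rewrite mulrNN mulr1|left; rewrite mulr1].
  + by rewrite mul1r.
- by move=> /etac e1 j k; rewrite !e1.
- by move=> A; rewrite mulrCA -PhiE mulrA cc mul1r.
Qed.
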